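(* Let $m\ge 2$ and $n\ge 1$ be integers and let $\mathcal{A}=(a_{i_1\cdots i_m})$ be a real $m$-th order $n$-dimensional tensor. Let $|\lambda|^{\max}_{\mathcal{A}}$ be the maximum of $|\lambda|$ over all Pareto-eigenvalues $\lambda$ of $\mathcal{A}$. Then $$|\lambda|^{\max}_{\mathcal{A}}\le\min\left\{n^{\frac{m-2}{2}}\|\mathcal{A}\|_F,\ \bar a\cdot n^{m-1}\right\},$$ where $\bar a=\max\{|a_{i_1i_2\cdots i_m}|: 1\le i_1,\ldots,i_m\le n\}$.
   Context: A real $m$-th order $n$-dimensional tensor is an array $\mathcal{A}=(a_{i_1\cdots i_m})$ with $a_{i_1\cdots i_m}\in\mathbb{R}$ for $1\le i_1,\ldots,i_m\le n$. For $x\in\mathbb{R}^n$, $\mathcal{A}x^{m-1}\in\mathbb{R}^n$ is the vector with $(\mathcal{A}x^{m-1})_i=\sum_{i_2,\ldots,i_m=1}^n a_{ii_2\cdots i_m}x_{i_2}\cdots x_{i_m}$. $\|\mathcal{A}\|_F=\big(\sum_{i_1,\ldots,i_m}a_{i_1\cdots i_m}^2\big)^{1/2}$ is the Frobenius norm. For $x\in\mathbb{R}^n$, $x^{[m-1]}=(x_1^{m-1},\ldots,x_n^{m-1})^\top$. Vector inequalities are componentwise. A Pareto-eigenvalue of $\mathcal{A}$ is a real number $\lambda$ for which there exists $x\in\mathbb{R}^n\setminus\{0\}$ with $x\ge 0$, $\lambda x^{[m-1]}-\mathcal{A}x^{m-1}\ge 0$ and $\langle x,\lambda x^{[m-1]}-\mathcal{A}x^{m-1}\rangle=0$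 (this is the eigenvalue complementarity problem for the pair $(\mathcal{A},\mathcal{I})$, with $\mathcal{I}$ the unit tensor, for which $\mathcal{I}x^{m-1}=x^{[m-1]}$). *)

(* Defs.v *)
From mathcomp Require Import all_boot all_order all_algebra.
From mathcomp Require Import all_classical all_reals all_analysis.

Set Implicit Arguments.
Unset Strict Implicit.
Unset Printing Implicit Defensive.

Import Order.TTheory GRing.Theory Num.Theory.

Local Open Scope classical_set_scope.
Local Open Scope ring_scope.

(* The multi-index (i_1, ..., i_m) is an m-tuple, with values in {0, ..., n-1}. *)
Definition tensor (R : realType) (m n : nat) : Type :=
  {ffun m.-tuple 'I_n -> R}.

(* The tuples s with head i are exactly the (i, i_2, ..., i_m), and behead s
   is then (i_2, ..., i_m). *)
Definition tensor_app (R : realType) (m n : nat)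
    (A : tensor R m n) (x : 'cV[R]_n) : 'cV[R]_n :=
  \col_i \sum_(s : m.-tuple 'I_n | ohead s == Some i)
    (A s * \prod_(j <- behead s) x j 0).

Definition frobenius_norm (R : realType) (m n : nat) (A : tensor R m n) : R :=
  Num.sqrt (\sum_(s : m.-tuple 'I_n) A s ^+ 2).

(* The base value 0 is harmless: the entries are absolute values, and there
   is at least one of them when n > 0. *)
Definition max_abs_entry (R : realType) (m n : nat) (A : tensor R m n) : R :=
  \big[Num.max/0]_(s : m.-tuple 'I_n) `|A s|.

Definition hadamard_pow (R : realType) (n : nat) (x : 'cV[R]_n) (k : nat) :
  'cV[R]_n := \col_i x i 0 ^+ k.

Definition nonneg_vec (R : realType) (n : nat) (x : 'cV[R]_n) : Prop :=
  forall i, 0 <= x i 0.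

Definition inner (R : realType) (n : nat) (x y : 'cV[R]_n) : R :=
  \sum_i x i 0 * y i 0.

Definition pareto_eigenvalue (R : realType) (m n : nat)
    (A : tensor R m n) (lambda : R) : Prop :=
  exists x : 'cV[R]_n,
    let w := lambda *: hadamard_pow x m.-1 - tensor_app A x in
    [/\ x != 0, nonneg_vec x, nonneg_vec w & inner x w = 0].

(* The maximum of |lambda|, taken as a supremum in the extended reals: an
   unbounded spectrum would give +oo (not a default value 0 as with sup on R)
   and an empty one -oo.  By max_abs_paretoE it is the maximum |l| whenever
   that is attained at some Pareto-eigenvalue l. *)
Definition max_abs_pareto (R : realType) (m n : nat) (A : tensor R m n) :
    \bar R :=
  ereal_sup [set `|lambda|%:E | lambda in pareto_eigenvalue A].

Lemma max_abs_paretoE (R : realType) (m n : nat) (A : tensor R m n) (l : R) :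
  pareto_eigenvalue A l ->
  (forall l', pareto_eigenvalue A l' -> `|l'| <= `|l|) ->
  max_abs_pareto A = `|l|%:E.
Proof.
move=> Al maxl; apply/le_anti/andP; split.
  by apply: ge_ereal_sup => _ [l' Al' <-]; rewrite lee_fin maxl.
by apply: ereal_sup_ubound; exists l.
Qed.

(* Main.v *)
(* Write S_k for the sum of the x_i ^ k.  Pairing the complementarity condition
   with x gives lambda S_m = sum_s A_s prod_(j in s) x_j, the sum running over
   all multi-indices s.  Cauchy-Schwarz bounds the right-hand side by
   ||A||_F S_2^(m/2), and the triangle inequality by a S_1^m with a the largest
   absolute entry.  The power mean inequality S_k^m <= n^(m-k) S_m^k, used with
   k = 2 and k = 1, turns these into multiples of S_m > 0. *)

Require Import Defs.
From mathcomp Require Import all_boot all_order all_algebra.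
From mathcomp Require Import all_classical all_reals all_analysis.
From mathcomp Require Import ring lra.

Import Order.TTheory GRing.Theory Num.Theory.

Local Open Scope ring_scope.

Lemma mulr_sub_exprB_ge0 (R : realDomainType) (x t : R) (e : nat) :
  0 <= x -> 0 <= t -> 0 <= (x - t) * (x ^+ e - t ^+ e).
Proof.
move=> x0 t0; rewrite subrXX mulrA -expr2 mulr_ge0 ?sqr_ge0//.
by apply: sumr_ge0 => i _; rewrite mulr_ge0 ?exprn_ge0.
Qed.

(** Increment for the induction on [d] in [weighted_AGM2]. Induction on [k]: [x] times the case [k],
    plus [(x - t) * (x ^+ (k + d).+1 - t ^+ (k + d).+1) >= 0], is exactly the case [k.+1]. *)
Lemma ler_exprB_tangent (R : realDomainType) (x t : R) (k d : nat) :
    0 <= x -> 0 <= t ->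
  t ^+ d.+1 * (x ^+ k - t ^+ k) <= k%:R * x ^+ (k + d) * (x - t).
Proof.
move=> x0 t0; elim: k => [|k IH]; first by rewrite !expr0 subrr mulr0 !mul0r.
have Q := mulr_sub_exprB_ge0 _ _ _ (k + d).+1 x0 t0.
have P := ler_wpM2l x0 IH.
rewrite -subr_ge0 in P; rewrite addSn -subr_ge0.
apply: le_trans (addr_ge0 P Q) _.
rewrite le_eqVlt; apply/orP; left; apply/eqP.
rewrite -(@natr1 _ k) !(exprS _ (k + d)) !exprD !exprS; ring.
Qed.

(** AM-GM with integer weights, free of roots: [t] times the case [d] plus [ler_exprB_tangent] is
    the case [d.+1]. For fixed [t] it bounds [x ^+ (k + d)] below by an affine function of
    [x ^+ k]. *)
Lemma weighted_AGM2 (R : realDomainType) (x t : R) (k d : nat) :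
    0 <= x -> 0 <= t ->
  (k + d)%:R * x ^+ k * t ^+ d <= k%:R * x ^+ (k + d) + d%:R * t ^+ (k + d).
Proof.
move=> x0 t0; elim: d => [|d IH]; first by rewrite !addn0 mulr1 mul0r addr0.
have P := ler_wpM2l t0 IH; have Q := ler_exprB_tangent _ _ _ k d x0 t0.
rewrite -subr_ge0 in P; rewrite -subr_ge0 in Q; rewrite -subr_ge0.
apply: le_trans (addr_ge0 P Q) _.
rewrite le_eqVlt; apply/orP; left; apply/eqP.
rewrite addnS !natrD -(@natr1 _ d) -(@natr1 _ (k + d)) natrD !(exprS _ (k + d)).
rewrite !exprD !exprS; ring.
Qed.

Lemma power_mean (R : realType) (I : finType) (x : I -> R) (k m : nat) :
    (0 < k <= m)%N -> (forall i, 0 <= x i) ->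
  (\sum_i x i ^+ k) ^+ m <= #|I|%:R ^+ (m - k) * (\sum_i x i ^+ m) ^+ k.
Proof.
move=> /andP[k0 km] x0; set N : R := #|I|%:R.
have S_ge0 e : 0 <= \sum_i x i ^+ e by apply: sumr_ge0 => i _; rewrite exprn_ge0.
have [I0|I0] := posnP #|I|.
  rewrite big1 ?expr0n ?gtn_eqF ?(leq_trans k0)//=.
    by rewrite mulr_ge0 ?exprn_ge0 ?ler0n.
  by move=> i; have := fintype0 i I0.
have N0 : 0 < N by rewrite ltr0n.
(* Sum the tangent inequality at the k-th power mean t of x. *)
pose t := (N^-1 * \sum_i x i ^+ k) `^ k%:R^-1.
have t0 : 0 <= t by exact: powR_ge0.
have tk : \sum_i x i ^+ k = N * t ^+ k.
  rewrite -powR_mulrn// -powRrM mulVf ?pnatr_eq0 -?lt0n// powRr1.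
    by rewrite mulVKf ?gt_eqF.
  by rewrite mulr_ge0 ?S_ge0 ?invr_ge0 ?ltW.
have le_tm : N * t ^+ m <= \sum_i x i ^+ m.
  have k0R : 0 < k%:R :> R by rewrite ltr0n.
  rewrite -(ler_pM2l k0R) -(subnKC km); set d := (m - k)%N.
  have : \sum_i ((k + d)%:R * x i ^+ k * t ^+ d) <=
         \sum_i (k%:R * x i ^+ (k + d) + d%:R * t ^+ (k + d)).
    by apply: ler_sum => i _; exact: weighted_AGM2.
  (* By [tk] the left side is [(k + d) * N * t ^+ (k + d)]; the term [d * N * t ^+ (k + d)]
     cancels. *)
  rewrite -mulr_suml -mulr_sumr tk big_split/= -mulr_sumr sumr_const.
  rewrite -[_ *+ #|I|]mulr_natl -/N natrD !exprD; lra.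
(* [(N * t ^+ k) ^+ m = N ^+ (m - k) * (N * t ^+ m) ^+ k], so [le_tm] raised to the power [k]
   concludes. *)
rewrite tk exprMn -exprM -{1}(subnK km) exprD -mulrA.
rewrite ler_wpM2l ?exprn_ge0 ?ler0n// mulnC exprM -exprMn.
by rewrite lerXn2r ?nnegrE ?mulr_ge0 ?exprn_ge0// ltW.
Qed.

Lemma cauchy_schwarz_sum (R : realDomainType) (I : finType) (a b : I -> R) :
  (\sum_i a i * b i) ^+ 2 <= (\sum_i a i ^+ 2) * (\sum_i b i ^+ 2).
Proof.
(* Lagrange's identity. *)
have : 0 <= \sum_i \sum_j (a i * b j - a j * b i) ^+ 2.
  by do 2!apply: sumr_ge0 => ? _; exact: sqr_ge0.
have -> : \sum_i \sum_j (a i * b j - a j * b i) ^+ 2 =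
    \sum_i \sum_j a i ^+ 2 * b j ^+ 2 + \sum_i \sum_j b i ^+ 2 * a j ^+ 2
    - 2 * \sum_i \sum_j (a i * b i) * (a j * b j).
  rewrite mulr_sumr -sumrN -!big_split; apply: eq_bigr => i _ /=.
  rewrite mulr_sumr -sumrN -!big_split; apply: eq_bigr => j _ /=; ring.
rewrite -!big_distrlr/= expr2; lra.
Qed.

Lemma sum_tuple_prod (R : pzSemiRingType) (I : finType) (m : nat) (f : I -> R) :
  \sum_(s : m.-tuple I) \prod_(j <- s) f j = (\sum_i f i) ^+ m.
Proof.
transitivity (\prod_(i < m) \sum_j f j); last by rewrite prodr_const card_ord.
(* Distributivity yields a sum over functions ['I_m -> I], which correspond bijectively to
   tuples. *)
rewrite bigA_distr_bigA.
rewrite (reindex (fun g : {ffun 'I_m -> I} => [tuple g i | i < m])) /=.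
  by apply: eq_bigr => g _; rewrite big_map enumT.
exists (fun s : m.-tuple I => [ffun i => tnth s i]) => s _.
  by apply/ffunP => i; rewrite ffunE tnth_mktuple.
by apply: eq_from_tnth => i; rewrite tnth_mktuple ffunE.
Qed.

Lemma inner_tensor_app (R : realType) (m n : nat) (A : tensor R m n)
    (x : 'cV[R]_n) : (0 < m)%N ->
  inner x (tensor_app A x) = \sum_(s : m.-tuple 'I_n) A s * \prod_(j <- s) x j 0.
Proof.
case: m A => // m A _; rewrite /inner.
under eq_bigr do rewrite mxE mulr_sumr.
(* For a given [s] only [i] equal to its head survives, and the factor [x i 0] completes the product
   over [behead s]. *)
rewrite (exchange_big_dep predT)//=; apply: eq_bigr => s _.
case/tupleP: s => h s /=; rewrite (big_pred1 h) => [|i]; last first.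
  by rewrite eq_sym; apply/eqP/eqP => [[]|->].
by rewrite big_cons mulrCA.
Qed.

Lemma inner_hadamard_pow (R : realType) (m n : nat) (x : 'cV[R]_n) : (0 < m)%N ->
  inner x (hadamard_pow x m.-1) = \sum_i x i 0 ^+ m.
Proof. by case: m => // m _; apply: eq_bigr => i _; rewrite mxE exprS. Qed.

Lemma pareto_eigenvalueP (R : realType) (m n : nat) (A : tensor R m n)
    (lambda : R) : (0 < m)%N -> pareto_eigenvalue A lambda ->
  exists x : 'cV[R]_n, [/\ forall i, 0 <= x i 0, 0 < \sum_i x i 0 ^+ m &
    lambda * \sum_i x i 0 ^+ m =
      \sum_(s : m.-tuple 'I_n) A s * \prod_(j <- s) x j 0].
Proof.
move=> m0 [x [xN0 x0 _ xw]]; exists x; split=> //.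
  rewrite lt_def sumr_ge0 ?andbT => [|i _]; last exact: exprn_ge0.
  (* A vanishing sum of nonnegative powers would force [x = 0]. *)
  apply: contraNneq xN0 => S0; apply/eqP/colP => i; rewrite mxE.
  have /eqP : x i 0 ^+ m = 0.
    by apply: (psumr_eq0P _ S0) => // j _; exact: exprn_ge0.
  by rewrite expf_eq0 m0 => /eqP.
rewrite -inner_tensor_app// -inner_hadamard_pow//.
apply/eqP; rewrite -subr_eq0 -xw; apply/eqP.
rewrite /inner mulr_sumr -sumrB; apply: eq_bigr => i _.
by rewrite !mxE mulrBr mulrCA.
Qed.

Lemma pareto_eigenvalue_frobenius (R : realType) (m n : nat) (A : tensor R m n)
    (lambda : R) : (2 <= m)%N -> pareto_eigenvalue A lambda ->
  `|lambda| <= n%:R `^ ((m%:R - 2) / 2) * frobenius_norm A.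
Proof.
move=> m2 /(pareto_eigenvalueP _ _ _ _ _ (ltnW m2))[x [x0 S0 eq_lambda]].
set S := \sum_i _ in S0 eq_lambda.
have F0 : 0 <= \sum_(s : m.-tuple 'I_n) A s ^+ 2.
  by apply: sumr_ge0 => s _; exact: sqr_ge0.
have c2 : (n%:R `^ ((m%:R - 2) / 2)) ^+ 2 = n%:R ^+ (m - 2) :> R.
  rewrite -[LHS]powR_mulrn ?powR_ge0// -powRrM divfK ?pnatr_eq0//.
  by rewrite -natrB// powR_mulrn.
rewrite -(ler_pM2r S0) -{1}(gtr0_norm S0) -normrM eq_lambda.
rewrite -ler_sqr ?nnegrE ?mulr_ge0 ?powR_ge0 ?sqrtr_ge0 ?(ltW S0)//.
rewrite real_normK ?num_real// !exprMn c2 sqr_sqrtr//.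
apply: le_trans (cauchy_schwarz_sum _ _ _ _) _.
rewrite [leRHS]mulrAC [leRHS]mulrC ler_wpM2l//.
(* Squared monomials are monomials in the [x j 0 ^+ 2], so they sum to the [m]-th power of the sum
   of squares. *)
under eq_bigr do rewrite -prodrXl.
rewrite sum_tuple_prod -[n in leRHS]card_ord.
exact: (@power_mean _ _ (fun i => x i 0) 2 m).
Qed.

Lemma pareto_eigenvalue_max_entry (R : realType) (m n : nat) (A : tensor R m n)
    (lambda : R) : (0 < m)%N -> pareto_eigenvalue A lambda ->
  `|lambda| <= max_abs_entry A * n%:R ^+ m.-1.
Proof.
move=> m0 /(pareto_eigenvalueP _ _ _ _ _ m0)[x [x0 S0 eq_lambda]].
set S := \sum_i _ in S0 eq_lambda.
have a0 : 0 <= max_abs_entry A by exact: bigmax_ge_id.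
rewrite -(ler_pM2r S0) -{1}(gtr0_norm S0) -normrM eq_lambda.
apply: le_trans (ler_norm_sum _ _ _) _.
apply: (@le_trans _ _ (max_abs_entry A * (\sum_i x i 0) ^+ m)).
  rewrite -sum_tuple_prod mulr_sumr ler_sum// => s _.
  have p0 : 0 <= \prod_(j <- s) x j 0 by apply: prodr_ge0 => j _; exact: x0.
  by rewrite normrM (ger0_norm p0) ler_wpM2r// le_bigmax.
rewrite -mulrA ler_wpM2l// -[n in leRHS]card_ord -subn1.
(* The first powers in this instance disappear by conversion. *)
exact: (@power_mean _ _ (fun i => x i 0) 1 m).
Qed.

Theorem theorem3p3 (R : realType) (m n : nat) (hm : (2 <= m)%N) (hn : (1 <= n)%N)
    (A : tensor R m n) :
  (max_abs_pareto A <=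
    (Num.min (n%:R `^ ((m%:R - 2) / 2) * frobenius_norm A)
             (max_abs_entry A * n%:R ^+ m.-1))%:E)%E.
Proof.
(* Bounding each eigenvalue suffices; no maximizer has to be exhibited. *)
apply: ge_ereal_sup => _ [lambda Alambda <-].
rewrite lee_fin le_min pareto_eigenvalue_frobenius//=.
exact: pareto_eigenvalue_max_entry _ _ _ _ _ (ltnW hm) Alambda.
Qed.
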